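(* Let $u_0\in \mathrm{BV}_{\mathrm{loc}}([0,+\infty))$ be right-continuous and nonnegative, with $u_0\in L^\infty((0,+\infty))\cap L^2((0,+\infty))$ and $\int_0^{+\infty}x\,u_0(x)\,dx<+\infty$, and suppose there exists $\alpha>0$ with $u_0(t)\ge\alpha$ for all $t\in[0,\alpha)$. Let $\hat u$ be the unique integral solution with initial datum $u_0$ and $\ell(r):=\hat u(r,r)$, and for $\tau\ge0$ put $$\mathfrak L(\hat u(\tau)):=\int_\tau^{+\infty}\int_{\xi-\tau}^{\xi-\tau+\hat u(\tau,\xi)}y\,dy\,d\xi=\frac12\int_\tau^{+\infty}\bigl(\hat u(\tau,\xi)^2+2(\xi-\tau)\hat u(\tau,\xi)\bigr)\,d\xi .$$ Then for all $\sigma,\tau\in[0,+\infty)$ with $\sigma<\tau$, $$\mathfrak L(\hat u(\tau))+\int_\sigma^\tau\int_{r+\ell(r)}^{+\infty}\hat u(r,\xi)\,d\xi\,dr=\mathfrak L(\hat u(\sigma)).$$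
   Context: $1_A$ is the characteristic function of $A$. $\mathrm{BV}_{\mathrm{loc}}([0,+\infty))$ is the class of functions on $[0,+\infty)$ having finite pointwise variation on $[0,a]$ for every $a>0$. Integral solution with initial datum $u_0$: a locally bounded function $w:\{(\tau,\xi):\tau>0,\ \xi>\tau\}\to[0,+\infty)$, defined everywhere, such that for any $\tau>0$ the limit $w(\tau,\tau):=\lim_{\xi\to\tau^+}w(\tau,\xi)$ exists in $[0,+\infty)$, and for every $(\tau,\xi)$ with $\tau>0$, $\xi>\tau$, $$w(\tau,\xi)=u_0(\xi)+\int_0^\tau 1_{(s,\,w(s,s)+s)}(\xi)\,ds.$$ Under the stated assumptions on $u_0$ there is a unique integral solution $\hat u$; it is extended to $\tau=0$ by $\hat u(0,\xi)=u_0(\xi)$. The function $\mathfrak L$ is the Lyapunov functional $\mathfrak L(u)=\int_0^{+\infty}\int_x^{x+u(x)}y\,dy\,dx$ evaluated at time $\tau$ on $x\mapsto\hat u(\tau,\tau+x)$; its domain is the set of nonnegative $u\in L^2((0,+\infty))$ with $xu\in L^1((0,+\infty))$. *)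

(* Defs.v *)
From HB Require Import structures.
From mathcomp Require Import all_boot all_order all_algebra.
From mathcomp Require Import all_classical all_reals all_analysis.

Set Implicit Arguments.
Unset Strict Implicit.
Unset Printing Implicit Defensive.

Import Order.TTheory GRing.Theory Num.Theory.
Import numFieldNormedType.Exports.

Local Open Scope classical_set_scope.
Local Open Scope ring_scope.

(* Functions on [0, +oo[ are represented by total functions [R -> R], and
   functions on {(t, x) : 0 < t < x} by total functions [R -> R -> R]; no
   definition below reads a value outside the mathematical domain. *)

Definition BV_loc (R : realType) (u0 : R -> R) : Prop :=
  forall a : R, 0 < a -> bounded_variation 0 a u0.

Definition right_continuous_ge0 (R : realType) (u0 : R -> R) : Prop :=
  forall x : R, 0 <= x -> u0 y @[y --> x^'+] --> u0 x.

(* The value w(t, t) on the diagonal. *)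
Definition diag (R : realType) (w : R -> R -> R) (t : R) : R :=
  lim (w t x @[x --> t^'+]).

Definition wedge (R : realType) : set (R * R) :=
  [set p | 0 < p.1 /\ p.1 < p.2].

(* For 0 < t < x, the integrand below is the indicator of the set of s in
   ]0, t[ with s + w(s, s) > x. Its integral over ]0, t[ is nonincreasing in x
   on ]t, +oo[ and continuous in t, and from this the integrand is Borel whenever
   u0 is right-continuous, so measurability is not part of the definition. *)
Definition integral_solution (R : realType) (u0 : R -> R) (w : R -> R -> R) :
    Prop :=
  [/\ forall t x : R, 0 < t -> t < x -> 0 <= w t x,
      [locally [bounded (w p.1 p.2 : R^o) | p in @wedge R]],
      forall t : R, 0 < t ->
        exists2 l : R, 0 <= l & w t x @[x --> t^'+] --> l
    & forall t x : R, 0 < t -> t < x ->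
        ((w t x)%:E = (u0 x)%:E +
          \int[lebesgue_measure]_(s in `]0%R, t[)
             (\1_(`]s, (diag w s + s)%R[) x)%:E)%E].

(* The integral solution extended to the diagonal and to time 0. *)
Definition extension (R : realType) (u0 : R -> R) (w : R -> R -> R) (t x : R) :
    R :=
  if t == 0 then u0 x else if x == t then diag w t else w t x.

(* The Lyapunov functional at time t, evaluated on x |-> u(t, t + x). *)
Definition lyapunov (R : realType) (u : R -> R -> R) (t : R) : \bar R :=
  (\int[lebesgue_measure]_(x in `]t, +oo[)
     \int[lebesgue_measure]_(y in `[(x - t)%R, (x - t + u t x)%R]) y%:E)%E.

(* Main.v *)
Require Import Defs.
From HB Require Import structures.
From mathcomp Require Import all_boot all_order all_algebra.
From mathcomp Require Import all_classical all_reals all_analysis.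
From mathcomp Require Import measurable_realfun.
From mathcomp Require Import ring lra.

Set Implicit Arguments.
Unset Strict Implicit.
Unset Printing Implicit Defensive.

Import Order.TTheory GRing.Theory Num.Theory.
Import numFieldNormedType.Exports.

Local Open Scope classical_set_scope.
Local Open Scope ring_scope.

(** Write l(r) = w(r, r) and g(r) = r + l(r) for the front. For 0 <= t <= x and
    0 < x the solution is u(t, x) = u0(x) + |{r in ]0, t[ : x < g(r)}|: this is
    the integral equation when t < x, and on the diagonal it follows from
    right-continuity of u0 and monotone convergence ([extension_height]). In
    particular the left and right limits of u at the diagonal agree, and the
    front is ahead of the diagonal by exactly u(r, r) ([front_diag]).

    For fixed x the energy u ^+ 2 / 2 + (x - t) * u is the integral of y over
    [x - t, x - t + u]. Its derivative in t is x - t while the front is beyond x,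
    and - u otherwise ([energy_along_characteristic]). Since u is only Lipschitz
    in t, the chain rule is replaced by the identity that the integral of a
    bounded function times its primitive is half the square of the primitive,
    which is Tonelli's theorem on a triangle ([Rintegral_primitive]).

    Integrating over x > s, until time t or until the diagonal reaches x, and
    exchanging the integrals ([height_energy_balance]): the points ahead of the
    front give the dissipation, the points between the diagonal and the front
    give a gain l(r) ^+ 2 / 2 per unit of time, and the points x of ]s, t[, which
    the diagonal overtakes, take away l(x) ^+ 2 / 2. The gain and the loss have
    the same integral, finite because u0 is square integrable, and cancel.

    The front has to be measurable before any of this makes sense. On t < x the
    difference w(t, x) - u0(x) is nondecreasing in t and nonincreasing in x,
    whether or not the front is measurable, so that l - u0 is a countable
    supremum of monotone functions cut off on intervals ([measurable_front]). *)

Section lyapunov_balance.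
Context {R : realType}.
Local Notation mu := (@lebesgue_measure R).
Local Notation T := (measurableTypeR R).

(** * Nonnegative integrals *)

(** Both integrals are suprema over the simple functions below the integrand.
    Stated for arbitrary functions, since the equation of an integral solution is
    used before its front is known to be measurable. *)
Lemma le_integral_nonneg (D E : set R) (f g : R -> \bar R) :
  (forall x, D x -> 0 <= f x)%E -> (forall x, E x -> 0 <= g x)%E ->
  (forall x, D x -> E x /\ f x <= g x)%E ->
  (\int[mu]_(x in D) f x <= \int[mu]_(x in E) g x)%E.
Proof.
move=> f0 g0 fg; rewrite !ge0_integralE//.
apply: ge_ereal_sup => _ [h /= hf <-]; apply: ereal_sup_ubound.
exists h => //= x; apply: le_trans (hf x) _.
rewrite /patch; case: ifPn => [|_]; rewrite ?inE.
  by move=> /fg[Ex fgx]; rewrite mem_set.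
by case: ifPn => //; rewrite inE => /g0.
Qed.

Lemma measurable_b2r d (U : measurableType d) (b : U -> bool) :
  measurable_fun setT b -> measurable_fun setT (fun x => (b x)%:R : R).
Proof.
move=> mb; apply: (@measurableT_comp _ _ _ _ _ _ (fun c : bool => c%:R : R)) => //.
Qed.

Lemma integral_mkbool (b : pred R) (k : R -> R) :
  (\int[mu]_(r in [set r | b r]) (k r)%:E = \int[mu]_r ((b r)%:R * k r)%:E)%E.
Proof.
rewrite integral_mkcond; apply: eq_integral => r _.
rewrite /patch mem_setE -topredE /=.
by case: (b r); rewrite ?mul1r ?mul0r.
Qed.

Section region.
Context d {U : measurableType d}.
Variables (E : R -> U -> bool) (k : R -> U -> R).
Hypothesis mE : measurable_fun [set: T * U] (fun p : T * U => E p.1 p.2).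
Hypothesis mk : measurable_fun [set: T * U] (fun p : T * U => k p.1 p.2).
Hypothesis k0 : forall r x, E r x -> 0 <= k r x.

Let K (p : T * U) := ((E p.1 p.2)%:R * k p.1 p.2)%:E : \bar R.

Let mK : measurable_fun [set: T * U] (fun p : T * U => K p : \bar R).
Proof.
by apply/measurable_EFinP; apply: measurable_funM => //; exact: measurable_b2r.
Qed.

Let K0 p : (0 <= K p)%E.
Proof.
by rewrite lee_fin; case: (boolP (E _ _)) => [/k0 ?|_]; rewrite ?mul1r ?mul0r.
Qed.

Lemma measurable_section_integral :
  measurable_fun [set: U]
    (fun x : U => (\int[mu]_(r in [set r | E r x]) (k r x)%:E)%E : \bar R).
Proof.
under eq_fun do rewrite integral_mkbool.
exact: (measurable_fun_fubini_tonelli_G K).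
Qed.

End region.

Lemma tonelli_region (E : R -> R -> bool) (k : R -> R -> R) :
  measurable_fun [set: T * T] (fun p : T * T => E p.1 p.2) ->
  measurable_fun [set: T * T] (fun p : T * T => k p.1 p.2) ->
  (forall r x, E r x -> 0 <= k r x) ->
  (\int[mu]_x \int[mu]_(r in [set r | E r x]) (k r x)%:E =
   \int[mu]_r \int[mu]_(x in [set x | E r x]) (k r x)%:E)%E.
Proof.
move=> mE mk k0; pose K (p : T * T) : \bar R := ((E p.1 p.2)%:R * k p.1 p.2)%:E.
under eq_integral do rewrite integral_mkbool.
under [RHS]eq_integral do rewrite integral_mkbool.
apply/esym/(fubini_tonelli K).
  by apply/measurable_EFinP; apply: measurable_funM => //; exact: measurable_b2r.
move=> p; rewrite lee_fin.
by case: (boolP (E _ _)) => [/k0 ?|_]; rewrite ?mul1r ?mul0r.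
Qed.

Lemma bounded_integrable_itvoo (a b M : R) (f : R -> R) :
  measurable_fun setT (f : T -> T) -> (forall x, a < x < b -> `|f x| <= M) ->
  mu.-integrable `]a, b[ (EFin \o f).
Proof.
move=> mf fM; apply: measurable_bounded_integrable => //.
- by rewrite /= lebesgue_measure_itv /=; case: ifP => _; rewrite ?ltry // -EFinB ltry.
- exact: measurable_funTS.
- exists M; split; first exact: num_real.
  move=> N MN x /=; rewrite in_itv /= => /fM fx.
  exact: le_trans fx (ltW MN).
Qed.

Lemma adde_cancel (x y z : \bar R) : x \is a fin_num ->
  (x + y = x + z)%E -> y = z.
Proof.
by move=> xfin yz; rewrite -(addeK y xfin) (addeC y) yz (addeC x) addeK.
Qed.

Lemma eq_integralD (D : set R) (f1 f2 g1 g2 : R -> \bar R) :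
  measurable (D : set T) ->
  measurable_fun D (f1 : T -> \bar R) -> measurable_fun D (f2 : T -> \bar R) ->
  measurable_fun D (g1 : T -> \bar R) -> measurable_fun D (g2 : T -> \bar R) ->
  (forall x, D x -> 0 <= f1 x)%E -> (forall x, D x -> 0 <= f2 x)%E ->
  (forall x, D x -> 0 <= g1 x)%E -> (forall x, D x -> 0 <= g2 x)%E ->
  (forall x, D x -> f1 x + f2 x = g1 x + g2 x)%E ->
  (\int[mu]_(x in D) f1 x + \int[mu]_(x in D) f2 x =
   \int[mu]_(x in D) g1 x + \int[mu]_(x in D) g2 x)%E.
Proof.
move=> mD mf1 mf2 mg1 mg2 f10 f20 g10 g20 fg.
rewrite -ge0_integralD// -ge0_integralD//.
by apply: eq_integral => x; rewrite inE => /fg.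
Qed.

Lemma integral_off0 (D : set R) (F G : R -> \bar R) :
  (forall x, D x -> F x = G x) -> (forall x, ~ D x -> G x = 0%E) ->
  (\int[mu]_(x in D) F x = \int[mu]_x G x)%E.
Proof.
move=> FG G0; rewrite integral_mkcond; apply: eq_integral => x _.
rewrite /patch; case: ifPn; first by rewrite inE => /FG.
by move=> /negP xD; rewrite G0// => Dx; apply: xD; rewrite inE.
Qed.

(** Both sides integrate over the triangle a < r < x < b. *)
Lemma tonelli_triangle (a b : R) (k : R -> R -> R) :
  measurable_fun [set: T * T] (fun p : T * T => k p.1 p.2) ->
  (forall r x, a < r -> r < x -> x < b -> 0 <= k r x) ->
  (\int[mu]_(x in `]a, b[) \int[mu]_(r in `]a, x[) (k r x)%:E =
   \int[mu]_(r in `]a, b[) \int[mu]_(x in `]r, b[) (k r x)%:E)%E.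
Proof.
move=> mk k0; pose E (r x : R) := [&& a < r, r < x & x < b].
rewrite (@integral_off0 _ _ (fun x => \int[mu]_(r in [set r | E r x]) (k r x)%:E)%E).
- rewrite (@tonelli_region E k).
  + apply/esym/integral_off0 => r; rewrite /= in_itv/=.
      move=> /andP[ar rb]; congr integral; apply/seteqP.
      by split => x /=; rewrite in_itv/= /E ar.
    move=> rab; rewrite (_ : [set _ | _] = set0) ?integral_set0//.
    apply/seteqP; split => // x /= /and3P[ar rx xb].
    by apply: rab; rewrite ar (lt_trans rx xb).
  + apply: measurable_and; first exact: measurable_fun_ltr.
    by apply: measurable_and; exact: measurable_fun_ltr.
  + exact: mk.
  + by move=> r x /and3P[]; exact: k0.
- move=> x; rewrite /= in_itv/= => /andP[ax xb]; congr integral; apply/seteqP.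
  by split => r /=; rewrite in_itv/= /E xb ?andbT.
- move=> x; rewrite /= in_itv/= => xab.
  rewrite (_ : [set _ | _] = set0) ?integral_set0//.
  apply/seteqP; split => // r /= /and3P[ar rx xb].
  by apply: xab; rewrite xb (lt_trans ar rx).
Qed.

(** Both sides integrate over the part a < r < b, r < x of the half-plane above
    the diagonal: a point x is seen until time [b] or until the diagonal reaches
    it, whichever comes first. *)
Lemma tonelli_strip (a b : R) (k : R -> R -> R) :
  measurable_fun [set: T * T] (fun p : T * T => k p.1 p.2) ->
  (forall r x, a < r -> r < b -> r < x -> 0 <= k r x) ->
  (\int[mu]_(x in `]a, +oo[) \int[mu]_(r in `]a, Num.min b x[) (k r x)%:E =
   \int[mu]_(r in `]a, b[) \int[mu]_(x in `]r, +oo[) (k r x)%:E)%E.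
Proof.
move=> mk k0; pose E (r x : R) := [&& a < r, r < b & r < x].
rewrite (@integral_off0 _ _ (fun x => \int[mu]_(r in [set r | E r x]) (k r x)%:E)%E).
- rewrite (@tonelli_region E k).
  + apply/esym/integral_off0 => r; rewrite /= in_itv/=.
      move=> /andP[ar rb]; congr integral; apply/seteqP.
      by split => x /=; rewrite in_itv/= /E ar rb ?andbT.
    move=> rab; rewrite (_ : [set _ | _] = set0) ?integral_set0//.
    apply/seteqP; split => // x /= /and3P[ar rb _].
    by apply: rab; rewrite ar rb.
  + apply: measurable_and; first exact: measurable_fun_ltr.
    by apply: measurable_and; exact: measurable_fun_ltr.
  + exact: mk.
  + by move=> r x /and3P[]; exact: k0.
- move=> x _; congr integral; apply/seteqP.
  by split => r /=; rewrite in_itv/= lt_min /E.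
- move=> x; rewrite /= in_itv/= andbT => /negP; rewrite -leNgt => xa.
  rewrite (_ : [set _ | _] = set0) ?integral_set0//.
  apply/seteqP; split => // r /= /and3P[ar _ rx].
  by have := lt_trans ar rx; rewrite ltNge xa.
Qed.

(** * Absolutely continuous primitives *)

Lemma Rintegral_itvoo1 (a b : R) : a <= b -> \int[mu]_(q in `]a, b[) (1 : R) = b - a.
Proof.
move=> ab; rewrite Rintegral_cst// mul1r /= lebesgue_measure_itv/= lte_fin.
by move: ab; rewrite le_eqVlt => /predU1P[->|->]; rewrite ?ltxx ?subrr.
Qed.

Section square.
Variable D : R -> R.
Hypothesis mD : measurable_fun setT (D : T -> T).
Hypothesis D01 : forall x, 0 <= D x <= 1.
Variable a : R.

Let Phi r := \int[mu]_(q in `]a, r[) D q.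

Let iD (c d : R) : mu.-integrable `]c, d[ (EFin \o D).
Proof.
apply: (@bounded_integrable_itvoo _ _ 1) => // x _.
by have /andP[D0 D1] := D01 x; rewrite ger0_norm.
Qed.

Lemma Rintegral_itvoo_split (x b : R) : a <= x -> x <= b ->
  \int[mu]_(q in `]a, b[) D q =
  \int[mu]_(q in `]a, x[) D q + \int[mu]_(q in `]x, b[) D q.
Proof.
move=> ax; rewrite le_eqVlt => /predU1P[->|xb].
  by rewrite set_itvoo0 Rintegral_set0 addr0.
have := @Rintegral_itvB R D (BRight a) (BLeft b) x (iD a b).
rewrite !bnd_simp => /(_ ax xb) <-.
by rewrite -Rintegral_itv_bndo_bndc// addrC subrK.
Qed.

Lemma measurable_primitive : measurable_fun setT (Phi : T -> T).
Proof.
apply: (measurableT_comp (@fine_measurable R _ measurableT)).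
have := @measurable_section_integral _ _ (fun q r => (a < q) && (q < r)) (fun q _ => D q).
apply => //.
- by apply: measurable_and; exact: measurable_fun_ltr.
- exact: measurableT_comp mD measurable_fst.
- by move=> r x _; have /andP[] := D01 r.
Qed.

Lemma primitive_bound r : a <= r -> 0 <= Phi r <= r - a.
Proof.
move=> ar; apply/andP; split.
  by apply: Rintegral_ge0 => x _; have /andP[] := D01 x.
rewrite -Rintegral_itvoo1//.
apply: le_Rintegral => //.
  by apply: (@bounded_integrable_itvoo _ _ 1) => // x _; rewrite normr1.
by move=> x _; have /andP[] := D01 x.
Qed.

Lemma EFin_mul_Rintegral (c d x : R) :
  ((D x * \int[mu]_(q in `]c, d[) D q)%:E = \int[mu]_(q in `]c, d[) (D x * D q)%:E)%E.
Proof.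
have D0 y : 0 <= D y by have /andP[] := D01 y.
under eq_integral do rewrite EFinM.
rewrite ge0_integralZl ?lee_fin//.
- by rewrite EFinM /Rintegral fineK//; exact: integrable_fin_num.
- by apply/measurable_EFinP; exact: measurable_funTS.
- by move=> y _; rewrite lee_fin.
Qed.

(* Tonelli on the triangle a < q < r < b. *)
Let swap (b : R) :
  \int[mu]_(r in `]a, b[) (D r * \int[mu]_(q in `]a, r[) D q) =
  \int[mu]_(r in `]a, b[) (D r * \int[mu]_(x in `]r, b[) D x).
Proof.
apply: (@congr1 _ _ fine).
transitivity (\int[mu]_(x in `]a, b[) \int[mu]_(r in `]a, x[) (D r * D x)%:E)%E.
  apply: eq_integral => x _; rewrite (EFin_mul_Rintegral a x x).
  by apply: eq_integral => r _; rewrite mulrC.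
rewrite (@tonelli_triangle a b (fun r x => D r * D x)).
- by apply: eq_integral => r _; rewrite (EFin_mul_Rintegral r b r).
- apply: measurable_funM; first exact: measurableT_comp mD measurable_fst.
  exact: measurableT_comp mD measurable_snd.
- move=> r x _ _ _; apply: mulr_ge0; first by have /andP[] := D01 r.
  by have /andP[] := D01 x.
Qed.

(** The chain rule for the square of a Lipschitz primitive Phi of [D]. Swapping
    the two integrations turns the integral of D * Phi into that of
    D * (Phi b - Phi), so it is half of Phi b ^+ 2; no differentiation almost
    everywhere is involved. *)
Lemma Rintegral_primitive (b : R) : a <= b ->
  \int[mu]_(r in `]a, b[) (D r * \int[mu]_(q in `]a, r[) D q) =
  (\int[mu]_(r in `]a, b[) D r) ^+ 2 / 2.
Proof.
move=> ab.
have D0 y : 0 <= D y by have /andP[] := D01 y.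
have D1 y : D y <= 1 by have /andP[] := D01 y.
have iP : mu.-integrable `]a, b[ (EFin \o (fun r => D r * Phi b)).
  apply: (@bounded_integrable_itvoo _ _ `|Phi b|).
    by apply: measurable_funM => //; exact: measurable_cst.
  by move=> x _; rewrite normrM ler_piMl// ger0_norm.
have iA : mu.-integrable `]a, b[ (EFin \o (fun r => D r * Phi r)).
  apply: (@bounded_integrable_itvoo _ _ (b - a)).
    by apply: measurable_funM => //; exact: measurable_primitive.
  move=> x /andP[/ltW ax /ltW xb]; rewrite normrM (ger0_norm (D0 x)).
  have /andP[P0 P1] := primitive_bound ax.
  rewrite (ger0_norm P0) (le_trans _ (_ : x - a <= b - a)) ?lerB//.
  by rewrite (le_trans _ P1)// ler_piMl.
have : \int[mu]_(r in `]a, b[) (D r * \int[mu]_(x in `]r, b[) D x) =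
    Phi b ^+ 2 - \int[mu]_(r in `]a, b[) (D r * Phi r).
  transitivity (\int[mu]_(r in `]a, b[) (D r * Phi b - D r * Phi r)).
    apply: eq_Rintegral => r; rewrite inE/= in_itv/= => /andP[ar rb].
    rewrite -mulrBr; congr (_ * _).
    have := Rintegral_itvoo_split (ltW ar) (ltW rb).
    by rewrite -/(Phi b) -/(Phi r) => ->; ring.
  by rewrite (RintegralB _ iP iA)// (RintegralZr _ _ (iD a b)).
rewrite -swap -/(Phi b) => half.
apply: (mulIf (_ : 2 != 0 :> R)) => //; rewrite divfK//.
by rewrite mulr_natr mulr2n {2}half; ring.
Qed.

End square.

Lemma integrable_EFinD (D : set R) (f g : R -> R) : measurable (D : set T) ->
  mu.-integrable D (EFin \o f) -> mu.-integrable D (EFin \o g) ->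
  mu.-integrable D (EFin \o (fun x => f x + g x)).
Proof.
move=> mD fi gi; have := integrableD mD fi gi.
by apply: eq_integrable.
Qed.

Lemma integrable_EFinB (D : set R) (f g : R -> R) : measurable (D : set T) ->
  mu.-integrable D (EFin \o f) -> mu.-integrable D (EFin \o g) ->
  mu.-integrable D (EFin \o (fun x => f x - g x)).
Proof.
move=> mD fi gi; have := integrableB mD fi gi.
by apply: eq_integrable.
Qed.

Lemma Rintegral_itvoo_id (a b : R) : a <= b ->
  \int[mu]_(r in `]a, b[) (r - a) = (b - a) ^+ 2 / 2.
Proof.
move=> ab; rewrite -(Rintegral_itvoo1 ab) -Rintegral_primitive//; last first.
  by move=> x; rewrite ler01 lexx.
apply: eq_Rintegral => r; rewrite inE/= in_itv/= => /andP[/ltW ar _].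
by rewrite mul1r Rintegral_itvoo1.
Qed.

Lemma EFin_Rintegral (D : set R) (f : R -> R) : measurable (D : set T) ->
  mu.-integrable D (EFin \o f) ->
  ((\int[mu]_(x in D) f x)%:E = \int[mu]_(x in D) (f x)%:E)%E.
Proof. by move=> mD fi; rewrite /Rintegral fineK//; exact: integrable_fin_num. Qed.

Lemma integral_itvoo_id (a b : R) : a <= b ->
  (\int[mu]_(r in `]a, b[) (r - a)%:E = ((b - a) ^+ 2 / 2)%:E)%E.
Proof.
move=> ab; rewrite -Rintegral_itvoo_id// EFin_Rintegral//.
apply: (@bounded_integrable_itvoo _ _ (b - a)).
  by apply: measurable_funB => //; exact: measurable_cst.
move=> r /andP[ar rb]; rewrite ger0_norm ?subr_ge0 ?(ltW ar)//.
by rewrite lerB// ltW.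
Qed.

(** * Energy at a fixed point *)

Section characteristic.
Variable h : R -> R.
Hypothesis mh : measurable_fun setT (h : T -> T).
Hypothesis h01 : forall x, 0 <= h x <= 1.
Variables a b c x : R.
Hypothesis ab : a <= b.

Let v r := c + \int[mu]_(q in `]a, r[) h q.
Let D r := 1 - h r.
Let Psi r := \int[mu]_(q in `]a, r[) D q.

Let mD : measurable_fun setT (D : T -> T).
Proof. by apply: measurable_funB => //; exact: measurable_cst. Qed.

Let D01 r : 0 <= D r <= 1.
Proof. by rewrite /D subr_ge0 lerBlDr lerDl andbC; exact: h01. Qed.

Let ih (p q : R) : mu.-integrable `]p, q[ (EFin \o h).
Proof.
apply: (@bounded_integrable_itvoo _ _ 1) => // y _.
by have /andP[h0 h1] := h01 y; rewrite ger0_norm.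
Qed.

Let i1 (p q : R) : mu.-integrable `]p, q[ (EFin \o (fun=> 1 : R)).
Proof. by apply: (@bounded_integrable_itvoo _ _ 1) => // y _; rewrite normr1. Qed.

(* The point x - r + v r moves with speed - D. Expressing everything through Psi
   leaves one nonlinear term, the integral of Psi * D, and makes the integrals of
   (r - a) * D cancel. *)
Let vE r : a <= r -> v r = c + (r - a) - Psi r.
Proof.
move=> ar; rewrite /v /Psi /D (RintegralB _ (i1 a r) (ih a r))//.
by rewrite Rintegral_itvoo1//; lra.
Qed.

Let bounded_mul (f g : R -> R) (M : R) : measurable_fun setT (f : T -> T) ->
  measurable_fun setT (g : T -> T) -> (forall r, 0 <= g r <= 1) ->
  (forall r, a < r < b -> `|f r| <= M) ->
  mu.-integrable `]a, b[ (EFin \o (fun r => f r * g r)).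
Proof.
move=> mf mg g01 fM; apply: (@bounded_integrable_itvoo _ _ M).
  exact: measurable_funM.
move=> r /fM fr; have /andP[g0 g1] := g01 r.
by rewrite normrM (le_trans _ fr)// (ger0_norm g0) ler_piMr.
Qed.

Let mPsi : measurable_fun setT (Psi : T -> T).
Proof. exact: measurable_primitive. Qed.

Let iPsiD : mu.-integrable `]a, b[ (EFin \o (fun r => Psi r * D r)).
Proof.
apply: (@bounded_mul _ _ (b - a)) => // r /andP[/ltW ar /ltW rb].
have /andP[P0 P1] := primitive_bound mD D01 ar.
by rewrite ger0_norm// (le_trans P1)// lerB.
Qed.

Let isubD : mu.-integrable `]a, b[ (EFin \o (fun r => (r - a) * D r)).
Proof.
apply: (@bounded_mul _ _ (b - a)) => //.
  by apply: measurable_funB => //; exact: measurable_cst.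
by move=> r /andP[/ltW ar /ltW rb]; rewrite ger0_norm ?subr_ge0// lerB.
Qed.

Let iD (k : R) : mu.-integrable `]a, b[ (EFin \o (fun r => k * D r)).
Proof.
by apply: (@bounded_mul _ _ `|k|) => //; exact: measurable_cst.
Qed.

Let isub : mu.-integrable `]a, b[ (EFin \o (fun r => r - a)).
Proof.
apply: (@bounded_integrable_itvoo _ _ (b - a)).
  by apply: measurable_funB => //; exact: measurable_cst.
by move=> r /andP[/ltW ar /ltW rb]; rewrite ger0_norm ?subr_ge0// lerB.
Qed.

Let icst (k : R) : mu.-integrable `]a, b[ (EFin \o (fun=> k)).
Proof. by apply: (@bounded_integrable_itvoo _ _ `|k|) => //. Qed.

Let iD1 : mu.-integrable `]a, b[ (EFin \o D).
Proof.
apply: (@bounded_integrable_itvoo _ _ 1) => // y _.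
by have /andP[D0 D1] := D01 y; rewrite ger0_norm.
Qed.

Let ivD : mu.-integrable `]a, b[ (EFin \o (fun r => v r * D r)).
Proof.
apply: (@eq_integrable _ _ _ mu `]a, b[ _ (EFin \o
  (fun r => c * D r + (r - a) * D r - Psi r * D r)) _) => //.
  move=> r; rewrite inE/= in_itv/= => /andP[/ltW ar _].
  by rewrite vE//; congr EFin; ring.
by apply: integrable_EFinB => //; exact: integrable_EFinD.
Qed.

Let int_vD : \int[mu]_(r in `]a, b[) (v r * D r) =
  c * Psi b + \int[mu]_(r in `]a, b[) ((r - a) * D r) - Psi b ^+ 2 / 2.
Proof.
transitivity (\int[mu]_(r in `]a, b[) (c * D r + (r - a) * D r - Psi r * D r)).
  apply: eq_Rintegral => r; rewrite inE/= in_itv/= => /andP[/ltW ar _].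
  by rewrite vE//; ring.
rewrite RintegralB//; last exact: integrable_EFinD.
rewrite RintegralD// RintegralZl//; congr (_ - _).
by rewrite -Rintegral_primitive//; apply: eq_Rintegral => r _; rewrite mulrC.
Qed.

Let hE r : h r * (x - r) = (x - a) - (r - a) - ((x - a) * D r - (r - a) * D r).
Proof. by rewrite /D; ring. Qed.

Let ihx : mu.-integrable `]a, b[ (EFin \o (fun r => h r * (x - r))).
Proof.
apply: (@eq_integrable _ _ _ mu `]a, b[ _ (EFin \o
  (fun r => (x - a) - (r - a) - ((x - a) * D r - (r - a) * D r))) _) => //.
  by move=> r _; rewrite /= hE.
by apply: integrable_EFinB => //; exact: integrable_EFinB.
Qed.

Let int_hx : \int[mu]_(r in `]a, b[) (h r * (x - r)) =
  (x - a) * (b - a) - (b - a) ^+ 2 / 2 -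
  ((x - a) * Psi b - \int[mu]_(r in `]a, b[) ((r - a) * D r)).
Proof.
under eq_Rintegral do rewrite hE.
rewrite (RintegralB _ (integrable_EFinB _ (icst (x - a)) isub)
  (integrable_EFinB _ (iD (x - a)) isubD))//.
rewrite (RintegralB _ (icst (x - a)) isub)// (RintegralB _ (iD (x - a)) isubD)//.
rewrite (RintegralZl _ _ iD1)// Rintegral_itvoo_id//; congr (_ - _ - _).
rewrite -(Rintegral_itvoo1 ab) -RintegralZl//.
by apply: eq_Rintegral => r _; rewrite mulr1.
Qed.

(** The energy v ^+ 2 / 2 + (x - r) * v at time r is the integral of y between
    x - r and x - r + v r. As r grows both ends move left with speed 1, and the
    right end moves back with speed [h r]; hence the derivative of the energy is
    h * (x - r) - v * (1 - h). *)
Lemma energy_along_characteristic :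
  ((v b ^+ 2 / 2 + (x - b) * v b)%:E +
     \int[mu]_(r in `]a, b[) (v r * (1 - h r))%:E =
   (c ^+ 2 / 2 + (x - a) * c)%:E +
     \int[mu]_(r in `]a, b[) (h r * (x - r))%:E)%E.
Proof.
rewrite -!EFin_Rintegral// -!EFinD; congr EFin.
by rewrite int_vD int_hx vE//; field.
Qed.

End characteristic.

Lemma integral_itvcc_id (a b : R) : 0 <= b ->
  (\int[mu]_(y in `[a, (a + b)%R]) y%:E = (b ^+ 2 / 2 + a * b)%:E)%E.
Proof.
move=> b0; have ab : a <= a + b by rewrite lerDl.
have mid : measurable_fun setT (id : T -> T) by exact: measurable_id.
rewrite (@integral_itv_bndoo R _ _ EFin); last by apply/measurable_EFinP.
have isub : mu.-integrable `]a, a + b[ (EFin \o (fun y => y - a)).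
  apply: (@bounded_integrable_itvoo _ _ b).
    by apply: measurable_funB => //; exact: measurable_cst.
  move=> y /andP[/ltW ay /ltW yb].
  by rewrite ger0_norm ?subr_ge0// lerBlDl.
have ia : mu.-integrable `]a, a + b[ (EFin \o (fun=> a)).
  by apply: (@bounded_integrable_itvoo _ _ `|a|).
transitivity (\int[mu]_(y in `]a, (a + b)%R[) ((y - a) + a)%:E)%E.
  by apply: eq_integral => y _; rewrite subrK.
rewrite -EFin_Rintegral//; last exact: integrable_EFinD.
rewrite RintegralD// Rintegral_itvoo_id//; congr ((_ + _)%:E).
  by rewrite addrC addKr.
have -> : \int[mu]_(y in `]a, a + b[) a = \int[mu]_(y in `]a, a + b[) (a * 1).
  by apply: eq_Rintegral => y _; rewrite mulr1.
rewrite RintegralZl// ?Rintegral_itvoo1//; first by rewrite [a + b]addrC addrK.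
by apply: (@bounded_integrable_itvoo _ _ 1) => // y _; rewrite normr1.
Qed.

(** * Heights fed by a front, and their energy balance *)

(** The explicit solution once the front [g] is given: at a fixed point [x] the
    height grows with speed 1 exactly while the front is beyond [x]. *)
Definition height (f g : R -> R) (t x : R) : R :=
  f x + \int[mu]_(r in `]0, t[) (x < g r)%R%:R.

Section height.
Variables f g : R -> R.
Hypothesis mf : measurable_fun setT (f : T -> T).
Hypothesis mg : measurable_fun setT (g : T -> T).
Hypothesis f0 : forall x, 0 <= f x.

Local Notation v := (height f g).

Let h01 (x r : R) : 0 <= ((x < g r)%R%:R : R) <= 1.
Proof. by case: (_ < _); rewrite ?lexx ?ler01. Qed.

Let mh x : measurable_fun setT ((fun r => (x < g r)%R%:R) : T -> T).
Proof. by apply: measurable_b2r; exact: measurable_fun_ltr. Qed.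

Lemma height_shift (s t x : R) : 0 <= s -> s <= t ->
  v t x = v s x + \int[mu]_(r in `]s, t[) (x < g r)%R%:R.
Proof.
move=> s0 st; rewrite /height -addrA; congr (_ + _).
exact: (@Rintegral_itvoo_split (fun r => (x < g r)%R%:R)).
Qed.

Lemma height_ge0 t x : 0 <= v t x.
Proof. by rewrite addr_ge0// Rintegral_ge0. Qed.

Lemma measurable_height : measurable_fun [set: T * T] (fun p : T * T => v p.1 p.2).
Proof.
apply: measurable_funD; first exact: measurableT_comp mf measurable_snd.
apply: (measurableT_comp (@fine_measurable R _ measurableT)).
apply: (@measurable_section_integral _ _
  (fun r (p : T * T) => (0 < r) && (r < p.1)) (fun r p => (p.2 < g r)%R%:R)).
- apply: measurable_and; first exact: measurable_fun_ltr.
  apply: measurable_fun_ltr => //.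
  exact: measurableT_comp measurable_fst measurable_snd.
- apply: measurable_b2r; apply: measurable_fun_ltr.
    exact: measurableT_comp measurable_snd measurable_snd.
  exact: measurableT_comp mg measurable_fst.
- by [].
Qed.

Let F t x := v t x ^+ 2 / 2 + (x - t) * v t x.

Let F_ge0 t x : t <= x -> 0 <= F t x.
Proof.
by move=> tx; rewrite addr_ge0 ?mulr_ge0 ?subr_ge0 ?sqr_ge0 ?invr_ge0 ?height_ge0.
Qed.

Let measurable_height_comp (phi psi : R -> R) : measurable_fun setT (phi : T -> T) ->
  measurable_fun setT (psi : T -> T) ->
  measurable_fun setT ((fun x => v (phi x) (psi x)) : T -> T).
Proof.
move=> mphi mpsi.
exact: (measurableT_comp measurable_height (measurable_fun_pair mphi mpsi)).
Qed.

Lemma measurable_energy (phi : R -> R) : measurable_fun setT (phi : T -> T) ->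
  measurable_fun setT ((fun x => F (phi x) x) : T -> T).
Proof.
move=> mphi; apply: measurable_funD.
  apply: measurable_funM; last exact: measurable_cst.
  by apply: measurable_funX; exact: measurable_height_comp.
apply: measurable_funM; last exact: measurable_height_comp.
exact: measurable_funB.
Qed.

Let measurable_heightr r : measurable_fun setT (v r : T -> T).
Proof. by apply: measurable_height_comp => //; exact: measurable_cst. Qed.

(* The points ahead of the front lose energy at rate v. *)
Let energy_off (r : R) : r <= g r ->
  (\int[mu]_(x in `]r, +oo[) (v r x * (1 - (x < g r)%R%:R))%:E =
   \int[mu]_(x in `]g r, +oo[) (v r x)%:E)%E.
Proof.
move=> rg; pose k x := v r x * (1 - (x < g r)%R%:R).
have mk : measurable_fun setT (k : T -> T).
  apply: measurable_funM; first exact: measurable_heightr.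
  apply: measurable_funB; first exact: measurable_cst.
  by apply: measurable_b2r; exact: measurable_fun_ltr.
rewrite [LHS](@integral_itv_obnd_cbnd _ _ _ (EFin \o k)); last first.
  by apply/measurable_EFinP; exact: measurable_funTS.
rewrite [RHS](@integral_itv_obnd_cbnd _ _ _ (EFin \o v r)); last first.
  by apply/measurable_EFinP; exact: (measurable_funTS (measurable_heightr r)).
rewrite [LHS]integral_mkcond [RHS]integral_mkcond; apply: eq_integral => x _.
rewrite /patch !mem_setE !in_itv/= !andbT /k.
have [gx|xg] := leP (g r) x; first by rewrite (le_trans rg gx) subr0 mulr1.
by rewrite subrr mulr0; case: ifP.
Qed.

(* A point x between the diagonal and the front gains energy at rate x - r. *)
Let energy_on (r : R) : r <= g r ->
  (\int[mu]_(x in `]r, +oo[) ((x < g r)%R%:R * (x - r))%:E =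
   ((g r - r) ^+ 2 / 2)%:E)%E.
Proof.
move=> rg; rewrite -integral_itvoo_id//.
rewrite [LHS]integral_mkcond [RHS]integral_mkcond; apply: eq_integral => x _.
rewrite /patch !mem_setE !in_itv/= !andbT.
by case: (r < x) => //=; case: (x < g r); rewrite ?mul1r ?mul0r.
Qed.

(* A point x of ]s, t[ leaves the half-line at time x, with energy
   v x x ^+ 2 / 2. *)
Let energy_split (s t : R) : s < t ->
  (\int[mu]_(x in `]s, +oo[) (F (Num.min t x) x)%:E =
   \int[mu]_(x in `]s, t[) (v x x ^+ 2 / 2)%:E +
   \int[mu]_(x in `]t, +oo[) (F t x)%:E)%E.
Proof.
move=> st.
have mF : measurable_fun setT ((fun x => F (Num.min t x) x) : T -> T).
  by apply: measurable_energy; exact: (measurable_minr (measurable_cst t)).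
rewrite (@itv_bndbnd_setU _ _ _ (BRight t)) ?bnd_simp ?ltW//.
have disj : [disjoint (`]s, t] : set R) & `]t, +oo[].
  apply/disj_setPS => x [/=]; rewrite !in_itv/= andbT => /andP[_ xt] tx.
  by have := le_lt_trans xt tx; rewrite ltxx.
rewrite (@ge0_integral_setU _ T R mu _ _ _ _ _ _ _ disj).
- rewrite -integral_itv_bndo_bndc; last first.
    by apply/measurable_EFinP; exact: (measurable_funTS mF).
  apply: congr2; apply: eq_integral => x; rewrite inE/= in_itv/=.
    by move=> /andP[_ xt]; rewrite min_r ?(ltW xt)// /F subrr mul0r addr0.
  by rewrite andbT => tx; rewrite min_l ?(ltW tx).
- exact: measurable_itv.
- exact: measurable_itv.
- by apply/measurable_EFinP; exact: (measurable_funTS mF).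
- by move=> x _; rewrite lee_fin F_ge0// ge_min lexx orbT.
Qed.

(** Integrating the balance at each x > s up to the time min t x at which x
    leaves the half-line, two terms appear that have no counterpart in the
    statement: the energy v x x ^+ 2 / 2 lost at the diagonal, and the energy
    (g r - r) ^+ 2 / 2 supplied between the diagonal and the front. They have
    the same integral because the front is ahead of the diagonal by exactly
    v r r. Finiteness of this integral is what permits cancelling it. *)
Lemma height_energy_balance (s t : R) : 0 <= s -> s < t ->
  (forall r, s < r < t -> g r = r + v r r) ->
  (\int[mu]_(r in `]s, t[) (v r r ^+ 2 / 2)%:E < +oo)%E ->
  (\int[mu]_(x in `]t, +oo[) (v t x ^+ 2 / 2 + (x - t) * v t x)%:E +
     \int[mu]_(r in `]s, t[) \int[mu]_(x in `]g r, +oo[) (v r x)%:E =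
   \int[mu]_(x in `]s, +oo[) (v s x ^+ 2 / 2 + (x - s) * v s x)%:E)%E.
Proof.
move=> s0 st gE diag_fin.
pose k1 r x := v r x * (1 - (x < g r)%R%:R).
pose k2 r x := (x < g r)%R%:R * (x - r).
pose I1 x := (\int[mu]_(r in `]s, Num.min t x[) (k1 r x)%:E)%E.
pose I2 x := (\int[mu]_(r in `]s, Num.min t x[) (k2 r x)%:E)%E.
have k1_ge0 r x : 0 <= k1 r x.
  by rewrite mulr_ge0 ?height_ge0// subr_ge0; case: (_ < _).
have k2_ge0 r x : r < x -> 0 <= k2 r x.
  by move=> rx; rewrite mulr_ge0 ?subr_ge0 ?(ltW rx).
have mind : measurable_fun [set: T * T] (fun p : T * T => (p.2 < g p.1)%R%:R : R).
  by apply: measurable_b2r; apply: measurable_fun_ltr => //;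
    exact: measurableT_comp mg measurable_fst.
have mk1 : measurable_fun [set: T * T] (fun p : T * T => k1 p.1 p.2).
  apply: measurable_funM; first exact: measurable_height.
  by apply: measurable_funB.
have mk2 : measurable_fun [set: T * T] (fun p : T * T => k2 p.1 p.2).
  apply: measurable_funM => //.
  by apply: measurable_funB; [exact: measurable_snd|exact: measurable_fst].
have mI (k : R -> R -> R) : measurable_fun [set: T * T] (fun p : T * T => k p.1 p.2) ->
    (forall r x, r < x -> 0 <= k r x) ->
    measurable_fun setT
    ((fun x => \int[mu]_(r in `]s, Num.min t x[) (k r x)%:E)%E : T -> \bar R).
  move=> mk k0.
  apply: (@measurable_section_integral _ _
    (fun r x => (s < r) && (r < Num.min t x)) k) => //.
    apply: measurable_and; first exact: measurable_fun_ltr.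
    apply: measurable_fun_ltr; first exact: measurable_fst.
    exact: (measurable_minr (measurable_cst t) measurable_snd).
  by move=> r x /andP[_]; rewrite lt_min => /andP[_]; exact: k0.
have along x : s < x ->
    ((F (Num.min t x) x)%:E + I1 x = (F s x)%:E + I2 x)%E.
  move=> sx; have sm : s <= Num.min t x by rewrite le_min !ltW.
  have E := energy_along_characteristic (mh x) (h01 x) (v s x) x sm.
  rewrite -(height_shift x s0 sm) in E; refine (etrans _ E).
  apply: (@congr1 _ _ (adde (F (Num.min t x) x)%:E)); apply: eq_integral => r.
  rewrite inE/= in_itv/= => /andP[/ltW sr _].
  by rewrite /k1 (height_shift x s0 sr).
have mFmin : measurable_fun setT ((fun x => F (Num.min t x) x) : T -> T).
  by apply: measurable_energy; exact: (measurable_minr (measurable_cst t)).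
have mFs : measurable_fun setT ((fun x => F s x) : T -> T).
  by apply: measurable_energy; exact: measurable_cst.
have rg r : s < r < t -> r <= g r by move=> /gE ->; rewrite lerDl height_ge0.
have I1E : (\int[mu]_(x in `]s, +oo[) I1 x =
    \int[mu]_(r in `]s, t[) \int[mu]_(x in `]g r, +oo[) (v r x)%:E)%E.
  rewrite (@tonelli_strip s t k1 mk1); last by move=> r x _ _ _; exact: k1_ge0.
  apply: eq_integral => r; rewrite inE/= in_itv/= => srt.
  exact: energy_off (rg r srt).
have I2E : (\int[mu]_(x in `]s, +oo[) I2 x =
    \int[mu]_(r in `]s, t[) (v r r ^+ 2 / 2)%:E)%E.
  rewrite (@tonelli_strip s t k2 mk2); last by move=> r x _ _; exact: k2_ge0.
  apply: eq_integral => r; rewrite inE/= in_itv/= => srt.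
  by rewrite (energy_on (rg r srt)) gE// addrC addKr.
have total : (\int[mu]_(x in `]s, +oo[) (F (Num.min t x) x)%:E +
      \int[mu]_(x in `]s, +oo[) I1 x =
    \int[mu]_(x in `]s, +oo[) (F s x)%:E + \int[mu]_(x in `]s, +oo[) I2 x)%E.
  apply: eq_integralD.
  - exact: measurable_itv.
  - by apply/measurable_EFinP; exact: (measurable_funTS mFmin).
  - by apply: measurable_funTS; apply: (mI k1 mk1) => r x _; exact: k1_ge0.
  - by apply/measurable_EFinP; exact: (measurable_funTS mFs).
  - exact: (measurable_funTS (mI k2 mk2 k2_ge0)).
  - by move=> x _; rewrite lee_fin; apply: F_ge0; rewrite ge_min lexx orbT.
  - by move=> x _; apply: integral_ge0 => r _; rewrite lee_fin; exact: k1_ge0.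
  - move=> x; rewrite /= in_itv/= andbT => sx; rewrite lee_fin; apply: F_ge0.
    exact: ltW.
  - move=> x _; apply: integral_ge0 => r; rewrite /= in_itv/= lt_min lee_fin.
    by move=> /and3P[_ _ rx]; exact: k2_ge0.
  - by move=> x; rewrite /= in_itv/= andbT; exact: along.
move: total; rewrite I1E I2E (energy_split st).
rewrite -addeA [in X in _ = X]addeC; apply: adde_cancel.
rewrite ge0_fin_numE//; apply: integral_ge0 => r _.
by rewrite lee_fin mulr_ge0 ?sqr_ge0.
Qed.

End height.

(** * Integral solutions are heights fed by their own front *)

Section solution.
Variables (u0 : R -> R) (w : R -> R -> R).
Hypothesis u0_rc : right_continuous_ge0 u0.
Hypothesis w_sol : integral_solution u0 w.
Hypothesis mu0 : measurable_fun setT (u0 \_ `]0, +oo[ : T -> T).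

Let edge (s : R) : R := s + diag w s.
Let gain (t x : R) : R := w t x - u0 x.
Let P (t : R) : R := diag w t - u0 t.

Let gainE (t x : R) : 0 < t -> t < x ->
  ((gain t x)%:E = \int[mu]_(s in `]0%R, t[) ((x < edge s)%R%:R)%R%:E)%E.
Proof.
move=> t0 tx; case: w_sol => _ _ _ /(_ t x t0 tx).
have -> : (\int[mu]_(s in `]0%R, t[) (\1_(`]s, (diag w s + s)%R[) x)%:E =
    \int[mu]_(s in `]0%R, t[) ((x < edge s)%R%:R)%R%:E)%E.
  apply: eq_integral => s; rewrite inE/= in_itv/= => /andP[_ st].
  by rewrite indicE mem_setE in_itv/= (lt_trans st tx) addrC.
case: (\int[mu]_(_ in _) _)%E => //= r [wE].
by congr EFin; rewrite /gain wE; ring.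
Qed.

(* This compares integrands not yet known to be measurable; the measurability of
   the front is deduced from it. *)
Let gain_le (t t' x x' : R) : 0 < t -> t <= t' -> t' < x -> x <= x' ->
  gain t x' <= gain t' x.
Proof.
move=> t0 tt' t'x xx'.
have tx' : t < x' by rewrite (le_lt_trans tt')// (lt_le_trans t'x).
rewrite -lee_fin gainE// gainE//; last exact: lt_le_trans tt'.
apply: le_integral_nonneg => s; rewrite ?lee_fin//= !in_itv/= => /andP[s0 st].
rewrite s0 (lt_le_trans st tt'); split => //.
rewrite ler_nat; case: (ltP x' (edge s)) => // x's.
by rewrite (le_lt_trans xx' x's).
Qed.

Let diag_cvg (t : R) : 0 < t -> w t x @[x --> t^'+] --> diag w t.
Proof.
move=> t0; case: w_sol => _ _ /(_ t t0)[l _ wl] _.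
by rewrite /diag (cvg_lim _ wl).
Qed.

Let gain_cvg (t : R) : 0 < t -> gain t x @[x --> t^'+] --> P t.
Proof. by move=> t0; apply: cvgB; [exact: diag_cvg|exact/u0_rc/ltW]. Qed.

Let gain_le_P (t x : R) : 0 < t -> t < x -> gain t x <= P t.
Proof.
move=> t0 tx; rewrite -(cvg_lim _ (gain_cvg t0))//.
apply: limr_ge; first by apply/cvg_ex; exists (P t); exact: gain_cvg.
near=> y; apply: gain_le => //.
by apply: ltW; near: y; exact: nbhs_right_lt.
Unshelve. all: end_near. Qed.

Let lt_P (t c : R) : 0 < t -> c < P t -> exists q : rat, t < ratr q /\ c < gain t (ratr q).
Proof.
move=> t0 cP; have /= := cvgr_gt _ (gain_cvg t0) _ cP.
move=> [e /= e0 He].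
have [q] : exists q : rat, ratr q \in `]t, t + e[ by apply: rat_in_itvoo; rewrite ltrDl.
rewrite in_itv/= => /andP[tq qe]; exists q; split => //; apply: He => //=.
by rewrite ltr0_norm ?subr_lt0// opprB ltrBlDl.
Qed.

(* P t is the supremum of gain t x over x > t, so a superlevel set of P is the
   union over rational q of the sets of t < q with c < gain t q; each of these is
   an interval since gain is nondecreasing in t. *)
Let mP : measurable_fun (`]0, +oo[ : set T) (P : T -> T).
Proof.
move=> mD; apply: (measurability _ (RGenOInfty.measurableE R)) => //.
move=> /= _ [_ [c ->] <-]; rewrite preimage_itvoy.
rewrite [X in measurable X](_ : _ = \bigcup_(q : rat)
    [set t | [/\ 0 < t, t < ratr q & c < gain t (ratr q)]]).
  apply: bigcupT_measurable_rat => q; apply: is_interval_measurable.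
  move=> a b [a0 aq ca] [b0 bq cb] y /andP[ay yb]; split.
  - exact: lt_le_trans a0 ay.
  - exact: le_lt_trans yb bq.
  - by apply: lt_le_trans ca _; apply: gain_le => //; exact: le_lt_trans yb bq.
apply/seteqP; split => t /=.
  rewrite in_itv/= andbT => -[t0 cP].
  by have [q [tq cq]] := lt_P t0 cP; exists q.
move=> [q _ [t0 tq cq]]; rewrite in_itv/= andbT t0; split => //.
exact: lt_le_trans cq (gain_le_P t0 tq).
Qed.

(** Cut off at times s <= 0 so as to be measurable on the whole line; no x > 0
    lies behind the front at such times. *)
Definition front : R -> R := edge \_ `]0, +oo[.

Let g := front.

Let gE (s : R) : 0 < s -> g s = edge s.
Proof. by move=> s0; rewrite /g /front patchE mem_setE in_itv/= s0. Qed.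

Lemma measurable_front : measurable_fun setT (g : T -> T).
Proof.
apply/(measurable_restrictT _ _).1 => //.
have mu0' : measurable_fun (`]0, +oo[ : set T) (u0 : T -> T).
  exact/(measurable_restrictT _ _).2.
have : measurable_fun (`]0, +oo[ : set T) ((fun s => s + (P s + u0 s)) : T -> T).
  by apply: measurable_funD => //; apply: measurable_funD.
by apply: eq_measurable_fun => s _; rewrite /edge /P subrK.
Qed.

Let gainE' (t x : R) : 0 < t -> t < x ->
  ((gain t x)%:E = \int[mu]_(s in `]0%R, t[) ((x < g s)%R%:R)%R%:E)%E.
Proof.
move=> t0 tx; rewrite gainE//; apply: eq_integral => s.
by rewrite inE/= in_itv/= => /andP[s0 _]; rewrite gE.
Qed.

Let mg (x : R) : measurable_fun setT ((fun s => (x < g s)%R%:R) : T -> T).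
Proof.
apply: measurable_b2r; apply: measurable_fun_ltr; first exact: measurable_cst.
exact: measurable_front.
Qed.

(* Monotone convergence as x decreases to t: the equation extends to the
   diagonal. *)
Let PE (t : R) : 0 < t -> ((P t)%:E = \int[mu]_(s in `]0%R, t[) ((t < g s)%R%:R)%R%:E)%E.
Proof.
move=> t0; pose x n := t + n.+1%:R^-1.
have tx n : t < x n by rewrite ltrDl invr_gt0 ltr0n.
have xt : x n @[n --> \oo] --> t.
  rewrite -[X in _ --> X]addr0; apply: cvgD; first exact: cvg_cst.
  exact: cvg_harmonic.
have gP : (gain t (x n))%:E @[n --> \oo] --> (P t)%:E.
  apply: cvg_EFin; first exact: nearW.
  exact: (cvg_at_rightP (gain t) t (P t)).1 (gain_cvg t0) x (conj tx xt).
pose h n (s : R) : \bar R := ((x n < g s)%R%:R)%R%:E.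
have mono s : nondecreasing_seq (h ^~ s).
  move=> m n mn; rewrite lee_fin ler_nat.
  case: (ltP (x m) (g s)) => // xg; rewrite (le_lt_trans _ xg)//.
  by rewrite lerD2l lef_pV2 ?posrE ?ltr0n// ler_nat ltnS.
have hlim s : limn (h ^~ s) = ((t < g s)%R%:R)%R%:E.
  apply: cvg_lim => //; have [tg|gt] := ltP t (g s); last first.
    apply: cvg_near_cst; apply: nearW => n.
    by rewrite /h ltNge (le_trans gt (ltW (tx n))).
  apply: cvg_near_cst.
  by apply: filterS (cvgr_lt _ xt _ tg) => n; rewrite /h => ->.
have hP : (\int[mu]_(s in `]0%R, t[) h n s)%E @[n --> \oo] -->
    (\int[mu]_(s in `]0%R, t[) limn (h ^~ s))%E.
  apply: (@cvg_monotone_convergence _ T R mu `]0, t[ _ h) => //.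
    by move=> n; apply/measurable_EFinP; exact: (measurable_funTS (mg (x n))).
  by move=> n s _; rewrite lee_fin.
have gh : (fun n => (gain t (x n))%:E) =
    (fun n => \int[mu]_(s in `]0%R, t[) h n s)%E.
  by apply/funext => n; exact: gainE'.
rewrite gh in gP; rewrite -(cvg_lim _ gP)// (cvg_lim _ hP)//.
by apply: eq_integral => s _; exact: hlim.
Qed.

(** The integral equation holds up to and including the diagonal, where
    right-continuity of [u0] identifies the limit. *)
Lemma extension_height (t x : R) : 0 <= t -> 0 < x -> t <= x ->
  extension u0 w t x = height (u0 \_ `]0, +oo[) g t x.
Proof.
move=> t0 x0 tx; rewrite /height patchE mem_setE in_itv/= x0/= /extension.
have [->|tn0] := eqVneq t 0; first by rewrite set_itvoo0 Rintegral_set0 addr0.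
have {}t0 : 0 < t by rewrite lt_neqAle eq_sym tn0.
have [->|xt] := eqVneq x t.
  by rewrite /Rintegral -PE// /P/= addrC subrK.
have {}tx : t < x by rewrite lt_neqAle eq_sym xt.
by rewrite /Rintegral -gainE'// /gain/= addrC subrK.
Qed.

Lemma front_diag (r : R) : 0 < r -> g r = r + height (u0 \_ `]0, +oo[) g r r.
Proof.
move=> r0; rewrite -(extension_height (ltW r0) r0 (lexx r)) (gE r0) /edge /extension.
by rewrite gt_eqF// eqxx.
Qed.

End solution.

(** * Integrability on the diagonal *)

Lemma height_le (f g : R -> R) (t x : R) : measurable_fun setT (g : T -> T) ->
  0 <= t -> height f g t x <= f x + t.
Proof.
move=> mg t0; rewrite lerD2l.
have mh : measurable_fun setT ((fun r => (x < g r)%R%:R) : T -> T).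
  by apply: measurable_b2r; exact: measurable_fun_ltr.
have h01 r : 0 <= ((x < g r)%R%:R : R) <= 1 by case: (_ < _); rewrite ?lexx ?ler01.
by have /andP[_] := primitive_bound mh h01 t0; rewrite subr0.
Qed.

(** The height grows with speed at most 1, so its square on the diagonal is
    bounded by a multiple of f r ^+ 2 + t ^+ 2. *)
Lemma height_diag_sqr_finite (f g : R -> R) (s t : R) :
  measurable_fun setT (f : T -> T) -> measurable_fun setT (g : T -> T) ->
  (forall x, 0 <= f x) -> 0 <= s ->
  mu.-integrable setT (EFin \o (fun x => f x ^+ 2)) ->
  (\int[mu]_(r in `]s, t[) (height f g r r ^+ 2 / 2)%:E < +oo)%E.
Proof.
move=> mf mg f0 s0 if2.
have if2' : mu.-integrable `]s, t[ (EFin \o (fun x => f x ^+ 2)).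
  by apply: integrableS if2.
have it2 : mu.-integrable `]s, t[ (EFin \o (fun=> t ^+ 2)).
  by apply: (@bounded_integrable_itvoo _ _ `|t ^+ 2|).
have /integrableP[_] := integrable_EFinD (measurable_itv _) if2' it2.
apply: le_lt_trans; apply: le_integral_nonneg => r.
- by move=> _; rewrite lee_fin mulr_ge0 ?sqr_ge0.
- by move=> _; exact: abse_ge0.
rewrite /= in_itv/= => /andP[sr rt]; split; first by rewrite sr.
have r0 : 0 <= r by rewrite (le_trans s0)// ltW.
have := height_ge0 g f0 r r; have := height_le f r mg r0.
rewrite lee_fin ger0_norm; last by rewrite addr_ge0 ?sqr_ge0.
set y := height _ _ _ _ => yle y0.
have yt : y <= f r + t by rewrite (le_trans yle)// lerD2l ltW.
have : y ^+ 2 <= (f r + t) ^+ 2 by rewrite ler_sqr// nnegrE (le_trans y0).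
have := sqr_ge0 (f r - t); nra.
Qed.

End lyapunov_balance.

Theorem mainTheorem4 (R : realType) (u0 : R -> R)
  (u0_BV : BV_loc u0)
  (u0_rc : right_continuous_ge0 u0)
  (u0_ge0 : forall x : R, 0 <= x -> 0 <= u0 x)
  (u0_Loo : u0 \_ `]0, +oo[ \in Lfun lebesgue_measure +oo%E)
  (u0_L2 : u0 \_ `]0, +oo[ \in Lfun lebesgue_measure 2%:E)
  (u0_mom : (\int[lebesgue_measure]_(x in `]0%R, +oo[) (x * u0 x)%:E < +oo)%E)
  (u0_alpha : exists2 alpha : R, 0 < alpha &
     forall t : R, 0 <= t -> t < alpha -> alpha <= u0 t)
  (w : R -> R -> R) (w_sol : integral_solution u0 w) :
  let u := extension u0 w in
  let l := fun r : R => u r r in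
  (forall t : R, 0 <= t ->
     (lyapunov u t = (2^-1)%R%:E *
       \int[lebesgue_measure]_(x in `]t, +oo[)
          (u t x ^+ 2 + 2 * (x - t) * u t x)%R%:E)%E) /\
  (forall s t : R, 0 <= s -> s < t ->
     (lyapunov u t +
       \int[lebesgue_measure]_(r in `]s, t[)
          \int[lebesgue_measure]_(x in `](r + l r)%R, +oo[) (u r x)%:E
      = lyapunov u s)%E).
Proof.
move=> u l.
pose f := u0 \_ `]0, +oo[; pose g := front w; pose v := height f g.
have mf : measurable_fun setT (f : measurableTypeR R -> measurableTypeR R).
  by move: u0_L2; rewrite inE => /andP[]; rewrite inE.
have f0 x : 0 <= f x.
  rewrite /f patchE; case: ifPn => //; rewrite mem_setE in_itv/= andbT => x0.
  exact/u0_ge0/ltW.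
have mg : measurable_fun setT (g : measurableTypeR R -> measurableTypeR R).
  exact: measurable_front u0_rc w_sol mf.
have uE t x : 0 <= t -> t < x -> u t x = v t x.
  by move=> t0 tx; apply: extension_height => //; rewrite ?ltW// (le_lt_trans t0).
have v0 t x : 0 <= v t x by exact: height_ge0.
have lyapunovE t : 0 <= t -> lyapunov u t =
    (\int[lebesgue_measure]_(x in `]t, +oo[)
       (v t x ^+ 2 / 2 + (x - t) * v t x)%R%:E)%E.
  move=> t0; apply: eq_integral => x; rewrite inE/= in_itv/= andbT => tx.
  by rewrite integral_itvcc_id uE.
split => [t t0|s t s0 st].
  transitivity ((2^-1)%R%:E * (2%:E * lyapunov u t))%E.
    by rewrite muleA -EFinM mulVf// mul1e.
  apply: (@congr1 _ _ (mule (2^-1)%:E)); rewrite (lyapunovE t t0) -ge0_integralZl.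
  - apply: eq_integral => x; rewrite inE/= in_itv/= andbT => tx.
    by rewrite (uE t x t0 tx) -EFinM; congr EFin; field.
  - exact: measurable_itv.
  - apply: measurable_funTS; apply/measurable_EFinP.
    exact: (measurable_energy mf mg (measurable_cst t)).
  - move=> x; rewrite /= in_itv/= andbT => /ltW tx.
    by rewrite lee_fin addr_ge0 ?mulr_ge0 ?subr_ge0 ?sqr_ge0.
  - by rewrite lee_fin.
rewrite !lyapunovE ?(le_trans s0 (ltW st))//.
rewrite -(height_energy_balance mf mg f0 s0 st).
- apply: (@congr1 _ _ (adde _)); apply: eq_integral => r; rewrite inE/= in_itv/=.
  move=> /andP[sr rt]; have r0 : 0 < r := le_lt_trans s0 sr.
  have lE : r + l r = g r.
    rewrite /g (front_diag u0_rc w_sol mf r0) /l /u.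
    by rewrite (extension_height u0_rc w_sol mf (ltW r0) r0 (lexx r)).
  rewrite lE; apply: eq_integral => x; rewrite inE/= in_itv/= andbT => gx.
  rewrite uE ?ltW// (le_lt_trans _ gx)// -lE lerDl.
  by rewrite /l /u (extension_height u0_rc w_sol mf (ltW r0) r0 (lexx r)).
- by move=> r /andP[sr _]; apply: front_diag => //; exact: le_lt_trans s0 sr.
- apply: height_diag_sqr_finite => //.
  exact: Lfun2_integrable_sqr.
Qed.
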